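(* Let $\alpha>0$ and $\beta\in[0,+\infty]$. For all $t>0$ and all $H\in\mathcal{S}_\beta(\mathbb{R})$, $$\Delta_\beta H\in\mathcal{S}_\beta(\mathbb{R})\qquad\text{and}\qquad T^\beta_t H\in\mathcal{S}_\beta(\mathbb{R}).$$
   Context: Fix $\alpha>0$ (it only matters when $\beta=1$). The space $\mathcal{S}(\mathbb{R}\backslash\{0\})$: functions $H:\mathbb{R}\to\mathbb{R}$ such that (i) $H\in C^\infty(\mathbb{R}\backslash\{0\})$; (ii) $H$ is continuous from the right at $0$; (iii) for all non-negative integers $k,\ell$, $\|H\|_{k,\ell}:=\sup_{u\neq 0}\left|(1+|u|^\ell)\frac{d^kH}{du^k}(u)\right|<\infty$. For such $H$ the side limits $\frac{d^kH}{du^k}(0^+)$ and $\frac{d^kH}{du^k}(0^-)$ exist for every integer $k\ge 0$. The space $\mathcal{S}_\beta(\mathbb{R})$: - for $\beta<1$, $\mathcal{S}_\beta(\mathbb{R})$ is the usual Schwartz space $\mathcal{S}(\mathbb{R})$; - for $\beta=1$, it is the set of $H\in\mathcal{S}(\mathbb{R}\backslash\{0\})$ such that for every integer $k\ge0$, $\frac{d^{2k+1}H}{du^{2k+1}}(0^+)=\frac{d^{2k+1}H}{du^{2k+1}}(0^-)=\alpha\left(\frac{d^{2k}H}{du^{2k}}(0^+)-\frac{d^{2k}H}{du^{2k}}(0^-)\right)$; - for $\beta>1$ (including $\beta=+\infty$), it is the set of $H\in\mathcal{S}(\mathbb{R}\backslash\{0\})$ such that for every integer $k\ge0$, $\frac{d^{2k+1}H}{du^{2k+1}}(0^+)=\frac{d^{2k+1}H}{du^{2k+1}}(0^-)=0$.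 The operator $\Delta_\beta$ acts on $H\in\mathcal{S}_\beta(\mathbb{R})$ by $\Delta_\beta H(u)=\frac{d^2H}{du^2}(u)$ for $u\ne0$ and $\Delta_\beta H(0)=\frac{d^2H}{du^2}(0^+)$. The semigroup $T^\beta_t$, $t>0$: let $\phi_t(x)=\frac{1}{\sqrt{4\pi t}}e^{-x^2/(4t)}$, $g_{\mathrm{even}}(x)=\frac{g(x)+g(-x)}{2}$, $g_{\mathrm{odd}}(x)=\frac{g(x)-g(-x)}{2}$, and $\mathrm{sign}(x)=1$ for $x\ge0$, $\mathrm{sign}(x)=-1$ for $x<0$. For $x\in\mathbb{R}$: - for $\beta\in[0,1)$, $T^\beta_t g(x)=\int_{\mathbb{R}}\phi_t(x-y)g(y)\,dy$; - for $\beta\in(1,+\infty]$, $T^\beta_t g(x)=\int_0^{+\infty}\left[\phi_t(x-y)+\phi_t(x+y)\right]g(y\,\mathrm{sign}(x))\,dy$; - for $\beta=1$, $$T^\beta_t g(x)=\int_{\mathbb{R}}\phi_t(x-y)g_{\mathrm{even}}(y)\,dy+\mathrm{sign}(x)e^{2\alpha|x|}\int_{|x|}^{+\infty}e^{-2\alpha z}\int_0^{+\infty}\left[\tfrac{z-y+4\alpha t}{2t}\phi_t(z-y)+\tfrac{z+y-4\alpha t}{2t}\phi_t(z+y)\right]g_{\mathrm{odd}}(y)\,dy\,dz.$$ *)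

(* Defs.v *)
From HB Require Import structures.
From mathcomp Require Import all_boot all_order all_algebra.
From mathcomp Require Import all_classical all_reals all_analysis.

Set Implicit Arguments.
Unset Strict Implicit.
Unset Printing Implicit Defensive.

Import Order.TTheory GRing.Theory Num.Theory.
Import numFieldNormedType.Exports.

Local Open Scope classical_set_scope.
Local Open Scope ring_scope.

(* Meant for an open set A, on which the iterated derivatives [derive1n k H]
   only depend on the values of H in A: every derivative of H is again
   derivable at every point of A, i.e. H is of class C^oo on A. *)
Definition smooth_on (R : realType) (A : set R) (H : R -> R) : Prop :=
  forall (k : nat) (u : R), A u -> derivable (derive1n k H) u 1.

Definition schwartz_norm (R : realType) (A : set R) (k l : nat) (H : R -> R)
    : \bar R :=
  ereal_sup [set (`|(1 + `|u| ^+ l) * derive1n k H u|)%:E | u in A].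

Definition schwartz (R : realType) : set (R -> R) :=
  [set H | smooth_on setT H /\
           forall k l : nat, (schwartz_norm setT k l H < +oo)%E].

Definition schwartz_punctured (R : realType) : set (R -> R) :=
  [set H | [/\ smooth_on [set~ 0] H,
               H u @[u --> (0 : R)^'+] --> H 0 &
               forall k l : nat,
                 (schwartz_norm [set~ 0%R] k l H < +oo)%E]].

(* [deriv_right0 k H] and [deriv_left0 k H] are the side limits at 0 of the
   k-th derivative; they exist for every H in S(R \ {0}). *)
Definition deriv_right0 (R : realType) (k : nat) (H : R -> R) : R :=
  lim (derive1n k H u @[u --> (0 : R)^'+]).

Definition deriv_left0 (R : realType) (k : nat) (H : R -> R) : R :=
  lim (derive1n k H u @[u --> (0 : R)^'-]).

Definition schwartz_robin (R : realType) (alpha : R) : set (R -> R) :=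
  [set H | schwartz_punctured H /\
           forall k : nat,
             deriv_right0 k.*2.+1 H = deriv_left0 k.*2.+1 H /\
             deriv_left0 k.*2.+1 H =
               alpha * (deriv_right0 k.*2 H - deriv_left0 k.*2 H)].

Definition schwartz_neumann (R : realType) : set (R -> R) :=
  [set H | schwartz_punctured H /\
           forall k : nat,
             deriv_right0 k.*2.+1 H = deriv_left0 k.*2.+1 H /\
             deriv_left0 k.*2.+1 H = 0].

Definition schwartz_beta (R : realType) (alpha : R) (beta : \bar R)
    : set (R -> R) :=
  if (beta < 1)%E then @schwartz R
  else if beta == 1%E then schwartz_robin alpha
  else @schwartz_neumann R.

(* Only the domain S_beta of the operator Delta_beta depends on beta, not the
   formula defining it. *)
Definition Delta (R : realType) (H : R -> R) : R -> R :=
  fun u => if u == 0 then deriv_right0 2 H else derive1n 2 H u.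

Definition heat_kernel (R : realType) (t x : R) : R :=
  (Num.sqrt (4 * pi * t))^-1 * expR (- (x ^+ 2 / (4 * t))).

Definition even_part (R : realType) (g : R -> R) : R -> R :=
  fun x => (g x + g (- x)) / 2.

Definition odd_part (R : realType) (g : R -> R) : R -> R :=
  fun x => (g x - g (- x)) / 2.

(* Unlike [Num.sg], this sign is 1 at 0. *)
Definition sign0 (R : realType) (x : R) : R := if 0 <= x then 1 else -1.

Definition T_line (R : realType) (t : R) (g : R -> R) : R -> R :=
  fun x => \int[lebesgue_measure]_y (heat_kernel t (x - y) * g y).

Definition T_neumann (R : realType) (t : R) (g : R -> R) : R -> R :=
  fun x => \int[lebesgue_measure]_(y in `[0, +oo[)
    ((heat_kernel t (x - y) + heat_kernel t (x + y)) * g (y * sign0 x)).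

Definition T_robin (R : realType) (alpha t : R) (g : R -> R) : R -> R :=
  fun x =>
    \int[lebesgue_measure]_y (heat_kernel t (x - y) * even_part g y) +
    sign0 x * expR (2 * alpha * `|x|) *
    \int[lebesgue_measure]_(z in `[`|x|, +oo[)
      (expR (- (2 * alpha * z)) *
       \int[lebesgue_measure]_(y in `[0, +oo[)
         (((z - y + 4 * alpha * t) / (2 * t) * heat_kernel t (z - y) +
           (z + y - 4 * alpha * t) / (2 * t) * heat_kernel t (z + y)) *
          odd_part g y)).

Definition T_beta (R : realType) (alpha : R) (beta : \bar R) (t : R)
    (g : R -> R) : R -> R :=
  if (beta < 1)%E then T_line t g
  else if beta == 1%E then T_robin alpha t g
  else T_neumann t g.

(* Main.v *)
Require Import Defs.
From mathcomp Require Import all_boot all_order all_algebra.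
From mathcomp Require Import all_classical all_reals all_analysis.
From mathcomp Require Import measurable_realfun lebesgue_integral_under.
From mathcomp Require Import ring lra.

(** Why the spaces are preserved.

    The operator is easy: away from 0 the k-th derivative of [Delta H] is the
    (k+2)-nd derivative of [H], so every condition on [Delta H] is a shifted
    condition on [H].  Only right-continuity at 0 needs an argument, namely
    that side limits of derivatives exist; this holds because a function with
    a bounded derivative on the half-line has a right limit at 0
    ([is_cvg_at_right0]).

    For the semigroup the point is that the Gaussian does all the work: the
    boundary conditions of the image of [H] come from the symmetry of the
    kernels, and [H] itself contributes the integrability of all its moments
    [y ^+ l * H y].

    - The functions [p(x) exp(- x^2 / 4t)], with [p] a polynomial, are bounded
      and stable under derivation and under multiplication by [x].  Hence the
      convolution of such a kernel with [g] may be differentiated forever, and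
      the identity [x (k * g) = (x k) * g + k * (x g)] turns the boundedness
      of convolutions into rapid decrease ([gauss_conv_tower],
      [gauss_conv_rapidly_decreasing]).  This settles [beta < 1].

    - For [beta > 1], each half of [T_neumann t H] has the form
      [u(x) + u(-x)] with [u] such a convolution; it is the restriction of an
      even smooth function, whose derivatives of odd order vanish at 0.

    - For [beta = 1], [T_robin alpha t H x] is [E(x) + sign(x) U(|x|)].  Here
      [E] is the convolution with the even part of [H], an even Schwartz
      function.  With [a = 2 alpha], [U x] is
      [exp(a x) \int_x^oo exp(- a z) w(z) dz] and
      solves [U' = a U - w], where the inner integral [w] has the form
      [u(z) - u(-z)], so it is odd.  Derivatives of even order of [w] vanish at
      0, hence [U^(2k+1)(0) = a U^(2k)(0)].  Since the jump of the derivative of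
      order [2k] of [T_robin alpha t H] at 0 is [2 U^(2k)(0)], and its
      derivative of order [2k+1] has both side limits equal to [U^(2k+1)(0)],
      this is the Robin condition.

    For [beta >= 1] the image is glued at 0 from two functions smooth on the
    whole line, and [glued_punctured], [glued_deriv0] read off membership in
    the space and the side limits of derivatives. *)

Set Implicit Arguments.
Unset Strict Implicit.
Unset Printing Implicit Defensive.

Import Order.TTheory GRing.Theory Num.Theory.
Import numFieldNormedType.Exports.

Local Open Scope classical_set_scope.
Local Open Scope ring_scope.

(** * Towers of derivatives and rapid decrease *)

Section Towers.
Context {R : realType}.
Implicit Types (A : set R) (F G : nat -> R -> R) (f g : R -> R).

(** Iterated derivatives are handled through an explicit sequence of witnesses:
    each closure property is then a single [is_derive] rule, and
    [derive1n_tower] converts the witnesses to [derive1n]. *)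
Definition tower A F :=
  forall k x, A x -> is_derive x 1 (F k) (F k.+1 x).

Definition rapidly_decreasing A f :=
  forall l, exists C, forall x, A x -> `|x| ^+ l * `|f x| <= C.

(** Being a derivative is local, so it is enough that [f] agrees with the bottom
    of the tower on the open set [A]. *)
Lemma derive1n_tower A F f : open A -> {in A, f =1 F 0%N} -> tower A F ->
  forall k, {in A, derive1n k f =1 F k}.
Proof.
move=> oA fF tF; elim=> [|k IH] x; first exact: fF.
rewrite inE => Ax; rewrite derive1nS derive1E.
have : is_derive x 1 (derive1n k f) (F k.+1 x).
  apply: near_eq_is_derive (tF k x Ax).
  near=> z; apply/esym/IH; rewrite inE; near: z; exact: open_nbhs_nbhs.
by move=> ?; rewrite derive_val.
Unshelve. all: by end_near. Qed.

Lemma smooth_on_tower A F f : open A -> {in A, f =1 F 0%N} -> tower A F ->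
  smooth_on A f.
Proof.
move=> oA fF tF k x Ax.
apply: (@near_eq_derivable _ _ _ (F k)); last exact: (@ex_derive _ _ _ _ _ _ _ (tF k x Ax)).
near=> z; apply/esym/(derive1n_tower oA fF tF); rewrite inE.
near: z; exact: open_nbhs_nbhs.
Unshelve. all: by end_near. Qed.

Lemma tower_derive1n A f : smooth_on A f -> tower A (fun k => derive1n k f).
Proof. by move=> sf k x Ax; rewrite derive1nS derive1E; apply/derivableP/sf. Qed.

Lemma is_derive_continuous f (x d : R) : is_derive x 1 f d -> {for x, continuous f}.
Proof. by move=> fd; apply/differentiable_continuous/derivable1_diffP; exact: ex_derive. Qed.

Lemma tower_continuous F k : tower setT F -> continuous (F k).
Proof. by move=> tF x; exact: is_derive_continuous (tF k x I). Qed.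

Lemma towerW A B F : A `<=` B -> tower B F -> tower A F.
Proof. by move=> AB tF k x /AB; exact: tF. Qed.

Lemma towerD A F G : tower A F -> tower A G -> tower A (fun k x => F k x + G k x).
Proof. by move=> tF tG k x Ax; apply: is_deriveD; [exact: tF|exact: tG]. Qed.

Lemma towerZ A F (c : R) : tower A F -> tower A (fun k x => c * F k x).
Proof. by move=> tF k x Ax; apply: is_deriveZ; exact: tF. Qed.

Lemma is_derive_opp f (x d : R) : is_derive (- x) 1 f d ->
  is_derive x 1 (fun z => f (- z)) (- d).
Proof.
move=> fd; have := @is_derive1_comp _ f -%R x d (-1) fd (is_deriveNid x 1).
by rewrite mulrN1.
Qed.

Lemma tower_reflect A F : tower [set - x | x in A] F ->
  tower A (fun k x => (-1) ^+ k * F k (- x)).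
Proof.
move=> tF k x Ax.
have h : is_derive (- x) 1 (F k) (F k.+1 (- x)) by apply: tF; exists x.
have := is_deriveZ ((-1) ^+ k) (is_derive_opp h).
by rewrite exprS mulN1r mulNr scalerN.
Qed.

Lemma rapidly_decreasingW A B f : A `<=` B ->
  rapidly_decreasing B f -> rapidly_decreasing A f.
Proof. by move=> AB rf l; have [C hC] := rf l; exists C => x /AB; exact: hC. Qed.

Lemma eq_rapidly_decreasing A f g : {in A, f =1 g} ->
  rapidly_decreasing A f -> rapidly_decreasing A g.
Proof.
move=> fg rf l; have [C hC] := rf l; exists C => x Ax.
by rewrite -fg ?inE//; exact: hC.
Qed.

Lemma rapidly_decreasingD A f g : rapidly_decreasing A f ->
  rapidly_decreasing A g -> rapidly_decreasing A (fun x => f x + g x).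
Proof.
move=> rf rg l; have [C hC] := rf l; have [D hD] := rg l; exists (C + D) => x Ax.
apply: le_trans (lerD (hC x Ax) (hD x Ax)).
by rewrite -mulrDr ler_wpM2l ?exprn_ge0// ler_normD.
Qed.

Lemma rapidly_decreasingZ A f c : rapidly_decreasing A f ->
  rapidly_decreasing A (fun x => c * f x).
Proof.
move=> rf l; have [C hC] := rf l; exists (`|c| * C) => x Ax.
by rewrite normrM mulrCA ler_wpM2l// hC.
Qed.

Lemma rapidly_decreasing_reflect A f : rapidly_decreasing [set - x | x in A] f ->
  rapidly_decreasing A (fun x => f (- x)).
Proof.
move=> rf l; have [C hC] := rf l; exists C => x Ax.
by rewrite -(normrN x); apply: hC; exists x.
Qed.

Lemma schwartz_norm_lty A f k :
  (forall l, (schwartz_norm A k l f < +oo)%E) <->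
  rapidly_decreasing A (derive1n k f).
Proof.
split=> [nf l|rf l].
- have [C hC] : exists C, forall x, A x ->
      `|(1 + `|x| ^+ l) * derive1n k f x| <= C.
    have := nf l; rewrite /schwartz_norm; set S := [set _ | _ in A].
    have ub x : A x -> ((`|(1 + `|x| ^+ l) * derive1n k f x|)%:E <= ereal_sup S)%E.
      by move=> Ax; apply: ereal_sup_ubound; exists x.
    case: (ereal_sup S) ub => [r| |] ub // _.
      by exists r => x /ub; rewrite lee_fin.
    by exists 0 => x /ub.
  exists C => x Ax; apply: le_trans (hC x Ax).
  by rewrite normrM ler_wpM2r// ger0_norm ?addr_ge0 ?exprn_ge0// lerDr.
- have [C hC] := rf l; have [D hD] := rf 0%N.
  apply: (@le_lt_trans _ _ (D + C)%:E); last exact: ltry.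
  apply: ub_ereal_sup => _ [x Ax <-]; rewrite lee_fin.
  rewrite normrM ger0_norm ?addr_ge0 ?exprn_ge0// mulrDl lerD ?hC//.
  by have := hD x Ax; rewrite expr0.
Qed.

End Towers.

(** * Side limits at the origin, gluing, and the operator Delta *)

Section SideLimits.
Context {R : realType}.
Implicit Types (A : set R) (F P Q : nat -> R -> R) (f g : R -> R).

Lemma open_neq0 : open ([set~ 0] : set R).
Proof. by apply: closed_openC; apply: accessible_closed_set1; exact: hausdorff_accessible. Qed.

(** Adding [M * x] makes [f] nondecreasing, and the mean value theorem bounds it
    from below near 0; so it has a right limit. *)
Lemma is_cvg_at_right0 f (df : R -> R) (M : R) :
  (forall x : R, 0 < x -> is_derive x 1 f (df x)) ->
  (forall x : R, 0 < x -> `|df x| <= M) ->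
  cvg (f u @[u --> 0^'+]).
Proof.
move=> fd dM.
pose g x := f x + M * x.
have gd (x : R) : 0 < x -> is_derive x 1 g (df x + M).
  move=> x0; have fx := fd x x0.
  have := is_deriveD fx (is_deriveZ M (is_derive_id x 1)).
  by rewrite [M *: 1]mulr1.
have gnd : {in `]0%R, 1[ &, {homo g : x y / x <= y}}.
  apply: ger0_derive1_le_oo.
  - by move=> x; rewrite in_itv/= => /andP[/gd ? _]; exact: ex_derive.
  - move=> x; rewrite in_itv/= => /andP[x0 _]; have ? := gd x x0.
    rewrite derive1E derive_val -lerBlDr sub0r.
    by have := dM x x0; rewrite ler_norml => /andP[].
  - move=> x; rewrite inE/= in_itv/= => /andP[/gd]; move=> gx _.
    exact: is_derive_continuous gx.
have glb : has_lbound (g @` `]0, 1[).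
  exists (g 2^-1 - 2 * M) => _ [x /= + <-]; rewrite in_itv/= => /andP[x0 x1].
  have M0 : 0 <= M by apply: le_trans (dM 1 ltr01).
  have [x2|x2] := leP 2^-1 x.
    apply: (@le_trans _ _ (g 2^-1)); first by rewrite gerBl mulr_ge0.
    by apply: gnd; rewrite // in_itv/= ?x0 ?x1//; apply/andP; split; lra.
  have [c cx Hc] : exists2 c, c \in `]x, 2^-1[%R & g 2^-1 - g x = (df c + M) * (2^-1 - x).
    apply: (@MVT _ g (fun z => df z + M)) => //.
      by move=> z; rewrite in_itv/= => /andP[xz _]; apply: gd; exact: lt_trans xz.
    apply: continuous_in_subspaceT => z; rewrite inE/= in_itv/= => /andP[xz _].
    by apply: is_derive_continuous; apply: gd; exact: lt_le_trans xz.
  have c0 : 0 < c by move: cx; rewrite in_itv/= => /andP[xc _]; exact: lt_trans xc.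
  have := dM c c0; rewrite ler_norml => /andP[dcMN dcM].
  rewrite lerBlDr -lerBlDl Hc.
  apply: (@le_trans _ _ (2 * M * 1)); last by rewrite mulr1.
  by apply: ler_pM; lra.
have gl := nondecreasing_at_right_cvgr (_ : (BRight 0 < BLeft 1)%O) gnd glb.
have {}gl := gl (ltac:(by rewrite bnd_simp)).
apply/cvg_ex; exists (inf (g @` `]0, 1[) - M * 0).
have -> : f = fun u => g u - M * u by apply/funext => u; rewrite /g addrK.
apply: cvgB => //; apply: cvgM; first exact: cvg_cst.
by apply: cvg_at_right_filter; exact: cvg_id.
Qed.

Lemma punctured_right_limit f k : schwartz_punctured f ->
  derive1n k f u @[u --> 0^'+] --> deriv_right0 k f.
Proof.
move=> [sf _ nf].
have [M hM] := (schwartz_norm_lty _ _ _).1 (nf k.+1) 0%N.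
apply: (@is_cvg_at_right0 _ (derive1n k.+1 f) M) => x x0.
  by apply: (tower_derive1n sf) => /= /eqP; rewrite gt_eqF.
by have := hM x; rewrite expr0 mul1r; apply => /= /eqP; rewrite gt_eqF.
Qed.

Lemma eq_lim_at_right f g : (forall x : R, 0 < x -> f x = g x) ->
  lim (f u @[u --> (0:R)^'+]) = lim (g u @[u --> (0:R)^'+]).
Proof.
move=> fg; congr (lim _); rewrite eqEsubset; split; apply: near_eq_cvg.
  by near=> x; apply: fg; near: x; exact: nbhs_right_gt.
by near=> x; apply/esym/fg; near: x; exact: nbhs_right_gt.
Unshelve. all: by end_near. Qed.

Lemma eq_lim_at_left f g : (forall x : R, x < 0 -> f x = g x) ->
  lim (f u @[u --> (0:R)^'-]) = lim (g u @[u --> (0:R)^'-]).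
Proof.
move=> fg; congr (lim _); rewrite eqEsubset; split; apply: near_eq_cvg.
  by near=> x; apply: fg; near: x; exact: nbhs_left_lt.
by near=> x; apply/esym/fg; near: x; exact: nbhs_left_lt.
Unshelve. all: by end_near. Qed.

Lemma glued_derive1n P Q f : tower setT P -> tower setT Q ->
  (forall x : R, 0 < x -> f x = P 0%N x) -> (forall x : R, x < 0 -> f x = Q 0%N x) ->
  (forall k x, 0 < x -> derive1n k f x = P k x) *
  (forall k x, x < 0 -> derive1n k f x = Q k x).
Proof.
move=> tP tQ fP fQ.
have tP' := @towerW _ [set x | 0 < x] setT P (fun _ _ => I) tP.
have tQ' := @towerW _ [set x | x < 0] setT Q (fun _ _ => I) tQ.
split=> k x x0.
- apply: (derive1n_tower (@open_gt R 0) _ tP'); last by rewrite inE.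
  by move=> y; rewrite inE; exact: fP.
- apply: (derive1n_tower (@open_lt R 0) _ tQ'); last by rewrite inE.
  by move=> y; rewrite inE; exact: fQ.
Qed.

(** Since [P k] and [Q k] are continuous across 0, side limits become plain
    values, which the symmetries of the two towers then determine. *)
Lemma glued_deriv0 P Q f : tower setT P -> tower setT Q ->
  (forall x : R, 0 < x -> f x = P 0%N x) -> (forall x : R, x < 0 -> f x = Q 0%N x) ->
  (forall k, deriv_right0 k f = P k 0) * (forall k, deriv_left0 k f = Q k 0).
Proof.
move=> tP tQ fP fQ; have [dP dQ] := glued_derive1n tP tQ fP fQ.
split=> k.
- rewrite /deriv_right0 (eq_lim_at_right (dP k)); apply/cvg_lim => //.
  by apply: cvg_at_right_filter; exact: tower_continuous.
- rewrite /deriv_left0 (eq_lim_at_left (dQ k)); apply/cvg_lim => //.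
  by apply: cvg_at_left_filter; exact: tower_continuous.
Qed.

Lemma glued_punctured P Q f : tower setT P -> tower setT Q ->
  (forall x, 0 <= x -> f x = P 0%N x) -> (forall x : R, x < 0 -> f x = Q 0%N x) ->
  (forall k, rapidly_decreasing [set x | 0 < x] (P k)) ->
  (forall k, rapidly_decreasing [set x | x < 0] (Q k)) ->
  schwartz_punctured f.
Proof.
move=> tP tQ fP fQ rP rQ.
have fP' x : 0 < x -> f x = P 0%N x by move/ltW; exact: fP.
have [dP dQ] := glued_derive1n tP tQ fP' fQ.
split.
- move=> k x /eqP; rewrite neq_lt => /orP[x0|x0].
  + apply: (smooth_on_tower (@open_lt R 0) _ (towerW (fun _ _ => I) tQ)) => //.
    by move=> y; rewrite inE; exact: fQ.
  + apply: (smooth_on_tower (@open_gt R 0) _ (towerW (fun _ _ => I) tP)) => //.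
    by move=> y; rewrite inE; exact: fP'.
- rewrite (fP 0)//.
  apply: cvg_trans (_ : P 0%N u @[u --> 0^'+] --> P 0%N 0); last first.
    by apply: cvg_at_right_filter; exact: tower_continuous.
  apply: near_eq_cvg; near=> x; apply/esym/fP'; near: x; exact: nbhs_right_gt.
- move=> k; apply/schwartz_norm_lty => l.
  have [C hC] := rP k l; have [D hD] := rQ k l.
  exists (Num.max C D) => x /eqP; rewrite neq_lt le_max => /orP[x0|x0].
  + by rewrite dQ// hD ?orbT.
  + by rewrite dP// hC.
Unshelve. all: by end_near. Qed.

(** The shift by two preserves the parity of the orders, which is why both kinds
    of boundary conditions are inherited by [Delta f]. *)
Lemma Delta_punctured f : schwartz_punctured f ->
  [/\ schwartz_punctured (Delta f),
      forall k, deriv_right0 k (Delta f) = deriv_right0 k.+2 f &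
      forall k, deriv_left0 k (Delta f) = deriv_left0 k.+2 f].
Proof.
move=> pf; have [sf cf nf] := pf.
pose F k := derive1n k.+2 f.
have tF : tower [set~ 0] F by move=> k x x0; exact: (tower_derive1n sf).
have DF : {in [set~ 0], Delta f =1 F 0%N}.
  by move=> x; rewrite inE /Delta => /eqP/negPf ->.
have dF k x : x != 0 -> derive1n k (Delta f) x = F k x.
  move=> x0; apply: (derive1n_tower open_neq0 DF tF).
  by rewrite inE; exact/eqP.
split.
- split.
  + exact: smooth_on_tower open_neq0 DF tF.
  + have -> : Delta f 0 = deriv_right0 2 f by rewrite /Delta eqxx.
    apply: (cvg_trans _ (punctured_right_limit (k := 2) pf)).
    apply: near_eq_cvg; near=> x; rewrite /Delta gt_eqF//; near: x; exact: nbhs_right_gt.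
  + move=> k; apply/schwartz_norm_lty.
    apply: eq_rapidly_decreasing ((schwartz_norm_lty _ _ _).1 (nf k.+2)).
    by move=> x; rewrite inE => /eqP x0; rewrite dF.
- by move=> k; apply: eq_lim_at_right => x x0; rewrite dF ?gt_eqF.
- by move=> k; apply: eq_lim_at_left => x x0; rewrite dF ?lt_eqF.
Unshelve. all: by end_near. Qed.

Lemma Delta_schwartz f : schwartz f -> schwartz (Delta f).
Proof.
move=> [sf nf].
have tf := tower_derive1n sf.
have -> : Delta f = derive1n 2 f.
  apply/funext => x; rewrite /Delta; case: eqVneq => // ->.
  apply/cvg_lim => //; apply: cvg_at_right_filter.
  exact: (tower_continuous (k := 2) tf).
have dE k : derive1n k (derive1n 2 f) = derive1n (k.+2) f.
  by rewrite /derive1n -iterD addn2.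
split=> [k x _|k l]; first by rewrite dE; exact: sf.
by rewrite /schwartz_norm dE; exact: nf.
Qed.

End SideLimits.

(** * Integrable moments *)

Section Moments.
Context {R : realType}.
Local Notation mu := (@lebesgue_measure R).
Implicit Types (D : set R) (f g : R -> R).

(** The decay class used for the functions that are convolved: unlike pointwise
    decay it also provides measurability, and it is visibly stable under
    multiplication by [y]. *)
Definition moments D g :=
  forall l, mu.-integrable D (EFin \o (fun y => y ^+ l * g y)).

Lemma integrable_oneDsqrV : mu.-integrable setT (EFin \o (fun y => (oneDsqr y)^-1)).
Proof.
apply/integrableP; split.
  apply/measurable_EFinP; apply: continuous_measurable_fun.
  exact: continuous_oneDsqrV.
under eq_integral.
  move=> x _; rewrite /= ger0_norm; last by rewrite invr_ge0 (le_trans ler01)// oneDsqr_ge1.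
  over.
rewrite ge0_symfun_integralT.
- rewrite (_ : [set x | _] = `[0, +oo[%classic); last first.
    by apply/seteqP; split => x/=; rewrite in_itv/= andbT.
  by rewrite integral0y_oneDsqr -EFinM ltry.
- by move=> x; rewrite invr_ge0 (le_trans ler01)// oneDsqr_ge1.
- exact: continuous_oneDsqrV.
- by move=> x /=; rewrite /oneDsqr sqrrN.
Qed.

(** Two extra powers of [y] buy the integrable weight [1 / (1 + y ^+ 2)]. *)
Lemma rapidly_decreasing_moments f : measurable_fun setT f ->
  rapidly_decreasing setT f -> moments setT f.
Proof.
move=> mf rf l; have [C hC] := rf l; have [E hE] := rf l.+2.
have gi := @integrableZl _ _ _ mu setT measurableT (C + E) _ integrable_oneDsqrV.
apply: le_integrable gi => //.
  apply/measurable_EFinP; apply: measurable_funM => //.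
move=> x _ /=; rewrite lee_fin normrM normrX.
rewrite (le_trans _ (ler_norm _))// -/(_ / _) ler_pdivlMr; last first.
  by rewrite (lt_le_trans ltr01)// oneDsqr_ge1.
rewrite /oneDsqr mulrDr mulr1 lerD ?hC// mulrAC.
by rewrite -[x ^+ 2]real_normK ?num_real// -exprD addn2 hE.
Qed.

Lemma moments_mulX D g : moments D g -> moments D (fun y => y * g y).
Proof.
move=> mg l; have := mg l.+1; congr (_.-integrable _ _).
by apply/funext => y /=; rewrite exprSr mulrA.
Qed.

Lemma moments_integrable D g : moments D g -> mu.-integrable D (EFin \o g).
Proof.
by move=> /(_ 0%N); congr (_.-integrable _ _); apply/funext => y /=; rewrite mul1r.
Qed.

Lemma momentsS D E g : measurable D -> measurable E -> D `<=` E ->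
  moments E g -> moments D g.
Proof. by move=> mD mE DE mg l; exact: integrableS (mg l). Qed.

Lemma integrable_bounded_mul D (h : R -> R) g (M : R) : measurable D ->
  measurable_fun D h -> (forall y, `|h y| <= M) ->
  mu.-integrable D (EFin \o g) -> mu.-integrable D (EFin \o (fun y => h y * g y)).
Proof.
move=> mD mh hM gi; apply: (@integrableMr _ _ _ mu D mD h (EFin \o g) mh _ gi).
by exists M; split; [exact: num_real|move=> y My x _ /=; exact: le_trans (hM x) (ltW My)].
Qed.

(** The Lebesgue measure is invariant under reflection; positive and negative
    parts are treated separately because the integral is defined from them. *)
Lemma Rintegral_reflect f : measurable_fun setT f ->
  \int[mu]_y f (- y) = \int[mu]_y f y.
Proof.
move=> mf; rewrite /Rintegral; congr fine.
have push (h : R -> \bar R) : measurable_fun setT h -> (forall x, (0 <= h x)%E) ->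
    (\int[mu]_y h (- y)%R = \int[mu]_y h y)%E.
  move=> mh h0.
  rewrite (_ : (\int[mu]_y h (- y)%R =
    \int[mu]_(y in (-%R : _ -> measurableTypeR R) @^-1` setT) (h (- y)%R))%E);
    last by rewrite preimage_setT.
  rewrite -ge0_integral_pushforward//=.
  by apply: eq_measure_integral => //= A mA _; exact: lebesgue_measureN.
have mEf : measurable_fun setT (EFin \o f) by exact/measurable_EFinP.
rewrite integralE [RHS]integralE; congr (_ - _)%E.
- rewrite -[RHS](push _ (measurable_funepos mEf) (funepos_ge0 _)).
  by apply: eq_integral => y _; rewrite !funeposE.
- rewrite -[RHS](push _ (measurable_funeneg mEf) (funeneg_ge0 _)).
  by apply: eq_integral => y _; rewrite !funenegE.
Qed.

End Moments.

(** * Convolution with a polynomial times a Gaussian *)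

Section GaussianConvolution.
Context {R : realType}.
Variable t : R.
Hypothesis t_gt0 : 0 < t.
Local Notation mu := (@lebesgue_measure R).
Implicit Types (D : set R) (f g : R -> R) (p : {poly R}).

Definition poly_gauss p (x : R) : R := p.[x] * expR (- (x ^+ 2 / (4 * t))).

(** The polynomial factor of the derivative of [poly_gauss p]. *)
Definition deriv_gauss p : {poly R} := p^`() - (2 * t)^-1 *: ('X * p).

Definition gauss_conv D p g (x : R) : R := \int[mu]_(y in D) (poly_gauss p (x - y) * g y).

Lemma heat_kernelE x :
  heat_kernel t x = poly_gauss ((Num.sqrt (4 * pi * t))^-1)%:P x.
Proof. by rewrite /poly_gauss hornerC. Qed.

Lemma heat_kernelN (x : R) : heat_kernel t (- x) = heat_kernel t x.
Proof. by rewrite /heat_kernel sqrrN. Qed.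

Lemma is_derive_poly_gauss p (x : R) :
  is_derive x 1 (poly_gauss p) (poly_gauss (deriv_gauss p) x).
Proof.
have d1 : is_derive x 1 (fun z : R => - (z ^+ 2 / (4 * t))) (- (x / (2 * t))).
  have h := is_deriveZ (- (4 * t)^-1)
    (is_deriveM (is_derive_id x (1 : R)) (is_derive_id x (1 : R))).
  have -> : (fun z : R => - (z ^+ 2 / (4 * t))) =
      (- (4 * t)^-1) \*: ((@id R) * (@id R)).
    apply/funext => z.
    by rewrite -[RHS]/(- (4 * t)^-1 * (z * z)) mulNr mulrC -expr2.
  apply: is_derive_eq h _; rewrite -![_ *: _]/(_ * _) /=; field.
  by rewrite gt_eqF.
have := is_deriveM (is_derive_poly p x) (is_derive1_comp (is_derive_expR _) d1).
move=> h; apply: (is_derive_eq h).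
rewrite /poly_gauss /deriv_gauss /= !hornerE /=.
rewrite -![_ *: _]/(_ * _).
by field; rewrite gt_eqF.
Qed.

Lemma poly_gauss_continuous p : continuous (poly_gauss p).
Proof. by move=> x; exact: is_derive_continuous (is_derive_poly_gauss p x). Qed.

(** It is enough to treat monomials; for these, one term of the exponential
    series at [z = x^2 / 4t] dominates [x^(2i+2)], hence [|x|^i] when
    [|x| > 1]. *)
Lemma poly_gauss_bounded p : exists M : R, forall x : R, `|poly_gauss p x| <= M.
Proof.
rewrite -[p]coefK poly_def.
elim/big_ind: _ => [|q r [M hM] [N hN]|i _].
- by exists 0 => x; rewrite /poly_gauss horner0 mul0r normr0.
- exists (M + N) => x; rewrite /poly_gauss hornerD mulrDl.
  exact: le_trans (ler_normD _ _) (lerD (hM x) (hN x)).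
exists (`|p`_i| * (1 + (i.+1)`!%:R * (4 * t) ^+ i.+1)) => x.
rewrite /poly_gauss hornerZ hornerXn -mulrA normrM ler_wpM2l//.
rewrite normrM normrX expRN [X in _ * X]ger0_norm ?invr_ge0 ?expR_ge0//.
rewrite -/(_ / _) ler_pdivrMr ?expR_gt0//.
have z0 : 0 <= x ^+ 2 / (4 * t) by rewrite divr_ge0 ?sqr_ge0// mulr_ge0 ?ltW.
set z := x ^+ 2 / (4 * t) in z0 *.
have t40 : 0 < 4 * t by rewrite mulr_gt0.
have ez1 : 1 <= expR z by rewrite -expR0 ler_expR.
have ezn : (x ^+ 2) ^+ i.+1 <= (i.+1)`!%:R * (4 * t) ^+ i.+1 * expR z.
  have h : z ^+ i.+1 / (i.+1)`!%:R <= expR z.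
    by apply: le_trans (expR_ge1Dxn i z0); rewrite lerDr ler01.
  rewrite mulrAC -ler_pdivrMr ?exprn_gt0// -expr_div_n -/z mulrC.
  by rewrite -ler_pdivrMr ?ltr0n ?fact_gt0.
rewrite mulrDl mul1r.
have [x1|x1] := leP `|x| 1.
  rewrite (@le_trans _ _ 1) ?exprn_ile1// (le_trans ez1)// lerDl.
  by rewrite !mulr_ge0 ?exprn_ge0 ?expR_ge0// ltW.
rewrite (@le_trans _ _ ((x ^+ 2) ^+ i.+1))//; last first.
  by rewrite (le_trans ezn)// lerDr expR_ge0.
rewrite -[x ^+ 2]real_normK ?num_real// -exprM.
by rewrite ler_weXn2l ?ltW// (leq_trans (leqnSn i))// leq_pmull.
Qed.

Lemma poly_gaussXM p x : poly_gauss ('X * p) x = x * poly_gauss p x.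
Proof. by rewrite /poly_gauss hornerM hornerX mulrA. Qed.

Lemma measurable_poly_gauss D p x : measurable_fun D (fun y => poly_gauss p (x - y)).
Proof.
apply: measurable_funTS; apply: continuous_measurable_fun => y.
apply: (@continuous_comp _ _ _ (fun y : R => x - y) (poly_gauss p)).
  by apply: continuousB; [exact: cvg_cst|exact: cvg_id].
exact: poly_gauss_continuous.
Qed.

Lemma gauss_conv_integrable D p g x : measurable D -> mu.-integrable D (EFin \o g) ->
  mu.-integrable D (EFin \o (fun y => poly_gauss p (x - y) * g y)).
Proof.
move=> mD gi; have [M hM] := poly_gauss_bounded p.
apply: (@integrable_bounded_mul _ D (fun y => poly_gauss p (x - y)) g M mD) => //.
exact: measurable_poly_gauss.
Qed.

(** Differentiation under the integral: the derivative of the kernel is bounded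
    by a constant [M], so the integrand is dominated by [M * |g y|]. *)
Lemma is_derive_gauss_conv D p g (x : R) : measurable D -> mu.-integrable D (EFin \o g) ->
  is_derive x 1 (gauss_conv D p g) (gauss_conv D (deriv_gauss p) g x).
Proof.
move=> mD gi.
pose f (a y : R) : R := poly_gauss p (a - y) * g y.
have fd (a y : R) : is_derive a 1 (f ^~ y) (poly_gauss (deriv_gauss p) (a - y) * g y).
  have h : is_derive a (1:R) (fun z : R => z - y) 1.
    by have := is_deriveB (is_derive_id a (1:R)) (is_derive_cst y a 1); rewrite subr0.
  have := @is_derive1_comp _ (poly_gauss p) (fun z => z - y) a _ 1
      (is_derive_poly_gauss p (a - y)) h.
  move=> /(is_deriveZ (g y)); rewrite mulr1 => k.
  have -> : f ^~ y = (g y \*: (poly_gauss p \o (fun z => z - y))).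
    by apply/funext => z; rewrite /f /= mulrC.
  by apply: is_derive_eq k _; rewrite mulrC.
have dE a y : partial1of2 f a y = poly_gauss (deriv_gauss p) (a - y) * g y.
  by have ? := fd a y; rewrite partial1of2E derive_val.
have [M hM] := poly_gauss_bounded (deriv_gauss p).
have M0 : 0 <= M by exact: le_trans (hM 0).
have xI : `]x - 1, x + 1[%classic x.
  by rewrite /= in_itv/=; apply/andP; split; lra.
have intf (a : R) : `]x - 1, x + 1[%classic a -> mu.-integrable D (EFin \o f a).
  by move=> _; exact: gauss_conv_integrable.
have derf (a y : R) : `]x - 1, x + 1[%classic a -> D y -> derivable (f ^~ y) a 1.
  by move=> _ _; have ? := fd a y; exact: ex_derive.
pose G (y : R) : R := M * `|g y|.
have G0 y : 0 <= G y by rewrite mulr_ge0.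
have iG : mu.-integrable D (EFin \o G).
  exact: (@integrableZl _ _ _ mu D mD M _ (integrable_norm gi)).
have Gub (a y : R) : `]x - 1, x + 1[%classic a -> D y -> `|partial1of2 f a y| <= G y.
  by move=> _ _; rewrite dE normrM ler_wpM2r.
have := @derivable_under_integral R _ _ mu f D mD x (x - 1) (x + 1) xI intf derf G G0 iG Gub.
move=> /derivableP; rewrite -derive1E => h.
apply: is_derive_eq h _.
rewrite (@differentiation_under_integral R _ _ mu f D mD x (x - 1) (x + 1) xI
  intf derf G G0 iG Gub).
by apply: eq_Rintegral => y _; rewrite dE.
Qed.

Lemma gauss_conv_tower D p g : measurable D -> mu.-integrable D (EFin \o g) ->
  tower setT (fun k => gauss_conv D (iter k deriv_gauss p) g).
Proof. by move=> mD gi k x _; exact: is_derive_gauss_conv. Qed.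

Lemma gauss_conv_bounded D p g : measurable D -> mu.-integrable D (EFin \o g) ->
  exists C : R, forall x : R, `|gauss_conv D p g x| <= C.
Proof.
move=> mD gi; have [M hM] := poly_gauss_bounded p.
exists (M * \int[mu]_(y in D) `|g y|) => x.
rewrite -RintegralZl//; last exact: integrable_norm.
apply: le_trans (@le_normr_Rintegral _ _ _ mu D _ mD (gauss_conv_integrable p x mD gi)) _.
apply: le_Rintegral => //.
- exact: (integrable_norm (gauss_conv_integrable p x mD gi)).
- exact: (@integrableZl _ _ _ mu D mD M _ (integrable_norm gi)).
- by move=> y _; rewrite normrM ler_wpM2r.
Qed.

(** From [x = (x - y) + y]: a factor [x] is absorbed either by the polynomial or
    by the moments of [g]. *)
Lemma mulX_gauss_conv D p g x : measurable D -> moments D g ->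
  x * gauss_conv D p g x = gauss_conv D ('X * p) g x + gauss_conv D p (fun y => y * g y) x.
Proof.
move=> mD mg; have gi := moments_integrable mg.
have gi1 := moments_integrable (moments_mulX mg).
rewrite /gauss_conv -RintegralZl//; last exact: gauss_conv_integrable.
rewrite -RintegralD//; [|exact: gauss_conv_integrable..].
by apply: eq_Rintegral => y _; rewrite poly_gaussXM; ring.
Qed.

Lemma gauss_conv_rapidly_decreasing D p g : measurable D -> moments D g ->
  rapidly_decreasing setT (gauss_conv D p g).
Proof.
move=> mD + l; elim: l p g => [|l IH] p g mg.
  have [C hC] := gauss_conv_bounded p mD (moments_integrable mg).
  by exists C => x _; rewrite expr0 mul1r.
have [C hC] := IH ('X * p) g mg.
have [E hE] := IH p _ (moments_mulX mg).
exists (C + E) => x _; rewrite exprSr -mulrA -normrM (mulX_gauss_conv _ _ mD mg).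
apply: le_trans (lerD (hC x I) (hE x I)).
by rewrite -mulrDr ler_wpM2l ?exprn_ge0// ler_normD.
Qed.

End GaussianConvolution.

(** * The exponential lift of the Robin problem *)

Section RobinLift.
Context {R : realType}.
Variable a : R.
Hypothesis a_ge0 : 0 <= a.
Local Notation mu := (@lebesgue_measure R).
Implicit Types (w : R -> R) (W : nat -> R -> R).

(** The solution of [U' = a U - w] that vanishes at [+oo], found with the
    integrating factor [exp(- a x)]. *)
Definition robin_lift w (x : R) : R :=
  expR (a * x) * \int[mu]_(z in `[x, +oo[) (expR (- (a * z)) * w z).

(** The derivatives of [robin_lift], as dictated by the differential equation
    [U' = a U - w]. *)
Definition robin_tower W : nat -> R -> R :=
  fix V k := if k is k'.+1 then fun x => a * V k' x - W k' x
             else robin_lift (W 0%N).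

Lemma continuous_exp_weight w : continuous w ->
  continuous (fun z => expR (- (a * z)) * w z).
Proof.
move=> cw z; apply: cvgM; last exact: cw.
apply: (@continuous_comp _ _ _ (fun z : R => - (a * z)) expR).
  by apply: cvgN; apply: cvgM; [exact: cvg_cst|exact: cvg_id].
exact: continuous_expR.
Qed.

Lemma integrable_exp_tail w x : continuous w -> mu.-integrable setT (EFin \o w) ->
  mu.-integrable `[x, +oo[ (EFin \o (fun z => expR (- (a * z)) * w z)).
Proof.
move=> cw wi.
have wx : mu.-integrable `[x, +oo[ (EFin \o w) by exact: integrableS wi.
have gi := @integrableZl _ _ _ mu `[x, +oo[ (measurable_itv _) (expR (- (a * x))) _ wx.
apply: le_integrable gi => //.
  apply/measurable_EFinP; apply: measurable_funTS; apply: continuous_measurable_fun.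
  exact: continuous_exp_weight.
move=> z /=; rewrite in_itv/= andbT => xz; rewrite lee_fin !normrM ler_wpM2r//.
by rewrite !ger0_norm ?expR_ge0// ler_expR lerN2 ler_wpM2l.
Qed.

(** Fundamental theorem of calculus, once the integral from [y] to [+oo],
    for [y] near [x], is a constant minus the integral from [x - 1] to [y]. *)
Lemma is_derive_robin_lift w (x : R) : continuous w -> mu.-integrable setT (EFin \o w) ->
  is_derive x 1 (robin_lift w) (a * robin_lift w x - w x).
Proof.
move=> cw wi.
pose h z := expR (- (a * z)) * w z.
pose V (y : R) : R := \int[mu]_(z in `[y, +oo[) h z.
have hi y : mu.-integrable `[y, +oo[ (EFin \o h) by exact: integrable_exp_tail.
have ch : continuous h by exact: continuous_exp_weight.
pose F (y : R) : R := \int[mu]_(z in `[x - 1, y]) h z.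
have VF (y : R) : x - 1 < y -> V (x - 1) - F y = V y.
  move=> xy; rewrite /V /F.
  rewrite (@Rintegral_itvB _ h (BLeft (x - 1)) +oo%O y (hi _)) ?bnd_simp//; last exact: ltW.
  apply: Rintegral_itv_obnd_cbnd.
  apply: integrableS (hi y) => //.
  by apply: subset_itv; rewrite ?bnd_simp.
have xx : x < x + 1 by rewrite ltrDl.
have xx1 : x - 1 < x by rewrite gtrBl.
have hx : mu.-integrable `[x - 1, x + 1] (EFin \o h).
  apply: integrableS (hi (x - 1)) => //.
  by apply: subset_itv; rewrite ?bnd_simp.
have [dF F'] := continuous_FTC1_closed xx hx xx1 (ch x).
have FD : is_derive x 1 F (h x) by rewrite -F' derive1E; exact/derivableP.
have VD : is_derive x 1 V (- h x).
  have k := is_deriveB (is_derive_cst (V (x - 1)) x 1) FD.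
  have {}k : is_derive x 1 (cst (V (x - 1)) - F) (- h x).
    by apply: is_derive_eq k _; rewrite sub0r.
  apply: near_eq_is_derive k; near=> y; apply: VF.
  by near: y; exact: lt_nbhsr.
have ED : is_derive x 1 (fun y => expR (a * y)) (a * expR (a * x)).
  have k := is_deriveZ a (is_derive_id x (1 : R)).
  have := @is_derive1_comp _ expR (fun y => a * y) x _ _ (is_derive_expR _) k.
  by move=> k'; apply: is_derive_eq k' _; rewrite -[_ *: _]/(_ * _) mulr1 mulrC.
have := is_deriveM ED VD => k.
apply: is_derive_eq k _.
rewrite -![_ *: _]/(_ * _) /robin_lift -/(V x) /h expRN.
by field; rewrite gt_eqF ?expR_gt0.
Unshelve. all: by end_near. Qed.

(** For [0 < x <= z] the weight [exp(a (x - z))] is at most 1 and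
    [x ^+ l <= z ^+ l], so the [l]-th moment of [w] is a bound. *)
Lemma robin_lift_rapidly_decreasing w : continuous w -> moments setT w ->
  rapidly_decreasing [set x | 0 < x] (robin_lift w).
Proof.
move=> cw mw l.
have wi := moments_integrable mw.
have iw := integrable_norm (mw l).
exists (\int[mu]_z `|z ^+ l * w z|) => x /= x0.
have mI : measurable `[x, +oo[ by exact: measurable_itv.
have hi := @integrable_exp_tail w x cw wi.
rewrite -normrX -normrM mulrA -RintegralZl//.
have hi' := @integrableZl _ _ _ mu `[x, +oo[ mI (x ^+ l * expR (a * x)) _ hi.
apply: le_trans (@le_normr_Rintegral _ _ _ mu _ _ mI hi') _.
have iwx : mu.-integrable `[x, +oo[ (EFin \o (fun z => `|z ^+ l * w z|)).
  exact: integrableS iw.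
apply: (@le_trans _ _ (\int[mu]_(z in `[x, +oo[) `|z ^+ l * w z|)).
  apply: le_Rintegral => //; first exact: (integrable_norm hi').
  move=> z /=; rewrite in_itv/= andbT => xz.
  rewrite mulrA -(mulrA (x ^+ l)) -expRD normrM [leRHS]normrM ler_wpM2r//.
  rewrite normrM.
  rewrite -[leRHS]mulr1 ler_pM ?exprn_ge0//.
    by rewrite !normrX lerXn2r ?nnegrE// !ger0_norm // ltW// (lt_le_trans x0).
  rewrite ger0_norm ?expR_ge0// -expR0 ler_expR -mulrBr.
  by rewrite mulr_ge0_le0// subr_le0.
rewrite fine_le//.
- exact: integrable_fin_num.
- exact: integrable_fin_num.
- by apply: ge0_subset_integral => //; exact: measurable_int iw.
Qed.

Lemma robin_tower_tower W : tower setT W -> mu.-integrable setT (EFin \o W 0%N) ->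
  tower setT (robin_tower W).
Proof.
move=> tW wi; elim=> [|k IH] x _.
  by apply: is_derive_robin_lift => //; exact: tower_continuous.
exact: (is_deriveB (is_deriveZ a (IH x I)) (tW k x I)).
Qed.

Lemma robin_tower_rapidly_decreasing W : tower setT W -> moments setT (W 0%N) ->
  (forall k, rapidly_decreasing setT (W k)) ->
  forall k, rapidly_decreasing [set x | 0 < x] (robin_tower W k).
Proof.
move=> tW mW rW; elim=> [|k IH].
  by apply: robin_lift_rapidly_decreasing => //; exact: tower_continuous.
have := rapidly_decreasingD (rapidly_decreasingZ a IH)
  (rapidly_decreasingZ (-1) (rapidly_decreasingW (fun _ _ => I) (rW k))).
by apply: eq_rapidly_decreasing => x _; rewrite mulN1r.
Qed.

End RobinLift.

(** * Symmetrization *)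

Section Symmetrization.
Context {R : realType}.
Implicit Types (F : nat -> R -> R).

Lemma sign_double k : (-1) ^+ k.*2 = 1 :> R.
Proof. by rewrite -signr_odd odd_double. Qed.

(** At 0 the derivatives of [F 0] and of its reflection agree, and the latter
    carry a sign [-1] at odd orders. *)
Lemma even_tower_deriv0 F k : tower setT F ->
  (forall x, F 0%N (- x) = F 0%N x) -> F k.*2.+1 0 = 0.
Proof.
move=> tF Fe.
have tr : tower setT (fun k x => (-1) ^+ k * F k (- x)).
  by apply: tower_reflect; apply: towerW tF.
have Fr : {in setT, F 0%N =1 fun x => (-1) ^+ 0 * F 0%N (- x)}.
  by move=> x _; rewrite expr0 mul1r Fe.
have := derive1n_tower openT Fr tr k.*2.+1 (mem_set (I : setT (0 : R))).
rewrite (derive1n_tower openT (fun _ _ => erefl) tF _ (mem_set I)).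
rewrite oppr0 exprS sign_double mulr1 mulN1r; lra.
Qed.

(** The tower over [F 0 x + s * F 0 (- x)]; the values of interest are [s = 1],
    the even symmetrization, and [s = -1], the odd one. *)
Definition symmetrize (s : R) F k (x : R) := F k x + s * ((-1) ^+ k * F k (- x)).

Lemma symmetrize_tower s F : tower setT F -> tower setT (symmetrize s F).
Proof.
move=> tF; apply: (towerD tF).
apply: (@towerZ _ _ (fun k x => (-1) ^+ k * F k (- x))).
by apply: tower_reflect; apply: towerW tF.
Qed.

Lemma symmetrize_rapidly_decreasing s F k : rapidly_decreasing setT (F k) ->
  rapidly_decreasing setT (symmetrize s F k).
Proof.
move=> rF; apply: (rapidly_decreasingD rF); do 2 apply: rapidly_decreasingZ.
by apply: rapidly_decreasing_reflect; apply: rapidly_decreasingW rF.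
Qed.

Lemma symmetrize0 s F x : symmetrize s F 0 x = F 0%N x + s * F 0%N (- x).
Proof. by rewrite /symmetrize expr0 mul1r. Qed.

Lemma symmetrize_deriv0 s F k : s * (-1) ^+ k = -1 -> symmetrize s F k 0 = 0.
Proof. by move=> sk; rewrite /symmetrize oppr0 mulrA sk mulN1r subrr. Qed.

End Symmetrization.

(** * The three semigroups *)

Section Preservation.
Context {R : realType}.
Variable t : R.
Hypothesis t_gt0 : 0 < t.
Local Notation mu := (@lebesgue_measure R).
Local Notation halfline := (`[(0 : R), +oo[%classic).
Implicit Types (f g H : R -> R).

Let mhalf : measurable halfline. Proof. exact: measurable_itv. Qed.

Lemma punctured_measurable f : schwartz_punctured f -> measurable_fun setT f.
Proof.
move=> [sf _ _].
rewrite -(setvU [set (0 : R)]) setUC; apply/measurable_funU => //.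
  exact: measurableC.
split; first exact: measurable_fun_set1.
apply: open_continuous_measurable_fun; first exact: open_neq0.
move=> x; rewrite inE => x0.
exact: is_derive_continuous (tower_derive1n sf 0%N x0).
Qed.

Lemma punctured_rapidly_decreasing f : schwartz_punctured f -> rapidly_decreasing setT f.
Proof.
move=> [_ _ nf] l; have [C hC] := (schwartz_norm_lty _ _ _).1 (nf 0%N) l.
exists (Num.max C (`|0 : R| ^+ l * `|f 0|)) => x _; rewrite le_max.
by have [->|/eqP x0] := eqVneq x 0; [rewrite lexx orbT|rewrite hC].
Qed.

Lemma schwartz_measurable f : schwartz f -> measurable_fun setT f.
Proof.
move=> [sf _]; apply: continuous_measurable_fun => x.
exact: is_derive_continuous (tower_derive1n sf 0%N I).
Qed.

Lemma schwartz_rapidly_decreasing f : schwartz f -> rapidly_decreasing setT f.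
Proof. by move=> [_ nf]; apply/(schwartz_norm_lty _ _ 0%N).1. Qed.

Lemma reflect_measurable f : measurable_fun setT f ->
  measurable_fun setT (fun x : R => f (- x)).
Proof. by move=> mf; exact: measurableT_comp. Qed.

Lemma rapidly_decreasing_reflectT f : rapidly_decreasing setT f ->
  rapidly_decreasing setT (fun x : R => f (- x)).
Proof. by move=> rf; apply: rapidly_decreasing_reflect; apply: rapidly_decreasingW rf. Qed.

Lemma schwartz_T_line H : schwartz H -> schwartz (T_line t H).
Proof.
move=> SH.
have mH := rapidly_decreasing_moments (schwartz_measurable SH) (schwartz_rapidly_decreasing SH).
set c : {poly R} := ((Num.sqrt (4 * pi * t))^-1)%:P.
have -> : T_line t H = gauss_conv t setT c H.
  by apply/funext => x; apply: eq_Rintegral => y _; rewrite heat_kernelE.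
have tc := gauss_conv_tower t_gt0 c measurableT (moments_integrable mH).
split; first by apply: smooth_on_tower openT _ tc.
move=> k; apply/schwartz_norm_lty => l.
have [C hC] := gauss_conv_rapidly_decreasing t_gt0 (iter k (deriv_gauss t) c) measurableT mH l.
by exists C => x _; rewrite (derive1n_tower openT _ tc) ?inE//; exact: hC.
Qed.

(** The reflected kernel creates the Neumann condition: on either side of 0 the
    image is an even symmetrization. *)
Lemma neumann_T_neumann H : schwartz_punctured H -> schwartz_neumann (T_neumann t H).
Proof.
move=> SH.
have mH := punctured_measurable SH; have rH := punctured_rapidly_decreasing SH.
have halfm g : measurable_fun setT g -> rapidly_decreasing setT g -> moments halfline g.
  by move=> mg rg; apply: (momentsS mhalf measurableT) => //; exact: rapidly_decreasing_moments.
set c : {poly R} := ((Num.sqrt (4 * pi * t))^-1)%:P.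
pose F g k := gauss_conv t halfline (iter k (deriv_gauss t) c) g.
pose P g := symmetrize 1 (F g).
have TP g : moments halfline g -> tower setT (P g).
  move=> mg; apply: symmetrize_tower; apply: gauss_conv_tower => //.
  exact: moments_integrable.
have rP g k : moments halfline g -> rapidly_decreasing setT (P g k).
  move=> mg; apply: symmetrize_rapidly_decreasing.
  exact: gauss_conv_rapidly_decreasing.
have P0 g x : moments halfline g ->
    \int[mu]_(y in halfline) ((heat_kernel t (x - y) + heat_kernel t (x + y)) * g y)
    = P g 0%N x.
  move=> mg; have gi := moments_integrable mg.
  rewrite /P symmetrize0 mul1r /F /= /gauss_conv -RintegralD//; [|exact: gauss_conv_integrable..].
  apply: eq_Rintegral => y _; rewrite -!heat_kernelE -opprD heat_kernelN.
  by rewrite mulrDl.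
have Podd g k : P g k.*2.+1 0 = 0.
  by apply: symmetrize_deriv0; rewrite exprS sign_double !mulr1 mul1r.
pose H' y := H (- y).
have m1 := halfm _ mH rH.
have m2 : moments halfline H'.
  by apply: halfm; [exact: reflect_measurable|exact: rapidly_decreasing_reflectT].
have TP1 (x : R) : 0 <= x -> T_neumann t H x = P H 0%N x.
  move=> x0; rewrite -P0//; apply: eq_Rintegral => y _.
  by rewrite /sign0 x0 mulr1.
have TP2 (x : R) : x < 0 -> T_neumann t H x = P H' 0%N x.
  move=> x0; rewrite -P0//; apply: eq_Rintegral => y _.
  by rewrite /sign0 leNgt x0 /= mulrN1.
have [dr dl] := glued_deriv0 (TP _ m1) (TP _ m2) (fun x x0 => TP1 x (ltW x0)) TP2.
split; last by move=> k; rewrite dr dl !Podd.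
apply: (glued_punctured (TP _ m1) (TP _ m2)) => // k.
- exact: rapidly_decreasingW (rP _ k m1).
- exact: rapidly_decreasingW (rP _ k m2).
Qed.

(** Right of 0 the odd part [V 0] of the image satisfies
    [V k.+1 = 2 alpha V k - W k], and [W 0] is odd, so [W k] vanishes at 0 for
    even [k]; the even part contributes nothing at odd orders. *)
Lemma robin_T_robin alpha H : 0 < alpha -> schwartz_punctured H ->
  schwartz_robin alpha (T_robin alpha t H).
Proof.
move=> alpha0 SH.
have mH := punctured_measurable SH; have rH := punctured_rapidly_decreasing SH.
have mH' := reflect_measurable mH; have rH' := rapidly_decreasing_reflectT rH.
have mE : moments setT (even_part H).
  apply: rapidly_decreasing_moments.
    by apply: measurable_funM => //; exact: measurable_funD.
  have := rapidly_decreasingZ 2^-1 (rapidly_decreasingD rH rH').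
  by apply: eq_rapidly_decreasing => x _; rewrite /even_part mulrC.
have mO : moments halfline (odd_part H).
  apply: (momentsS mhalf measurableT) => //.
  apply: rapidly_decreasing_moments.
    by apply: measurable_funM => //; exact: measurable_funB.
  have := rapidly_decreasingZ 2^-1 (rapidly_decreasingD rH (rapidly_decreasingZ (-1) rH')).
  by apply: eq_rapidly_decreasing => x _; rewrite /odd_part mulrC mulN1r.
set c : {poly R} := ((Num.sqrt (4 * pi * t))^-1)%:P.
pose E k := gauss_conv t setT (iter k (deriv_gauss t) c) (even_part H).
have tE : tower setT E by apply: gauss_conv_tower => //; exact: moments_integrable.
have rE k : rapidly_decreasing setT (E k) by exact: gauss_conv_rapidly_decreasing.
have Eodd k : E k.*2.+1 0 = 0.
  apply: (even_tower_deriv0 k tE) => x; rewrite /E /= /gauss_conv.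
  rewrite -[RHS]Rintegral_reflect.
    apply: eq_Rintegral => y _; rewrite -!heat_kernelE opprK -heat_kernelN opprD !opprK.
    by rewrite /even_part opprK [H y + _]addrC.
  apply: measurable_funM; first exact: measurable_poly_gauss.
  by apply: measurable_funM => //; exact: measurable_funD.
(* The second kernel of the inner integral is, up to sign, the first one at
   [- z]: this is what makes that integral odd in [z]. *)
pose q : {poly R} := (2 * t)^-1 *: (('X + (4 * alpha * t)%:P) * c).
have qE x : poly_gauss t q x = (x + 4 * alpha * t) / (2 * t) * heat_kernel t x.
  rewrite heat_kernelE /poly_gauss /q hornerZ hornerM hornerD hornerX !hornerC.
  by rewrite mulrCA !mulrA.
pose K k := gauss_conv t halfline (iter k (deriv_gauss t) q) (odd_part H).
have tK : tower setT K by apply: gauss_conv_tower => //; exact: moments_integrable.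
have rK k : rapidly_decreasing setT (K k) by exact: gauss_conv_rapidly_decreasing.
pose W := symmetrize (-1) K.
have tW : tower setT W by exact: symmetrize_tower.
have rW k : rapidly_decreasing setT (W k) by exact: symmetrize_rapidly_decreasing.
have mW : moments setT (W 0%N).
  apply: rapidly_decreasing_moments => //; apply: continuous_measurable_fun.
  exact: tower_continuous.
have W0 z : \int[mu]_(y in halfline)
    (((z - y + 4 * alpha * t) / (2 * t) * heat_kernel t (z - y) +
      (z + y - 4 * alpha * t) / (2 * t) * heat_kernel t (z + y)) * odd_part H y)
    = W 0%N z.
  have oi := moments_integrable mO.
  rewrite /W symmetrize0 mulN1r /K /= /gauss_conv -RintegralB//; [|exact: gauss_conv_integrable..].
  apply: eq_Rintegral => y _; rewrite !qE -[heat_kernel t (- z - y)]heat_kernelN.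
  by rewrite opprD !opprK; ring.
have Weven k : W k.*2 0 = 0.
  by apply: symmetrize_deriv0; rewrite sign_double mulr1.
have a0 : 0 <= 2 * alpha by rewrite mulr_ge0 ?ltW.
pose V := robin_tower (2 * alpha) W.
have tV : tower setT V by apply: robin_tower_tower => //; exact: moments_integrable.
have rV k : rapidly_decreasing [set x | 0 < x] (V k) by exact: robin_tower_rapidly_decreasing.
have VS k : V k.+1 0 = 2 * alpha * V k 0 - W k 0 by [].
have TE x : T_robin alpha t H x = E 0%N x + sign0 x * V 0%N `|x|.
  rewrite /T_robin -mulrA; congr (_ + _ * _).
    by apply: eq_Rintegral => y _; rewrite heat_kernelE.
  rewrite /V /= /robin_lift; congr (_ * _).
  by apply: eq_Rintegral => z _; rewrite W0.
pose P k x := E k x + V k x.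
pose Q k x := E k x + -1 * ((-1) ^+ k * V k (- x)).
have tP : tower setT P by exact: towerD.
have tQ : tower setT Q.
  apply: (towerD tE); apply: (@towerZ _ _ (fun k x => (-1) ^+ k * V k (- x))).
  by apply: tower_reflect; apply: towerW tV.
have TP (x : R) : 0 <= x -> T_robin alpha t H x = P 0%N x.
  by move=> x0; rewrite TE /sign0 x0 mul1r ger0_norm.
have TQ (x : R) : x < 0 -> T_robin alpha t H x = Q 0%N x.
  by move=> x0; rewrite TE /sign0 leNgt x0 /= ltr0_norm// /Q expr0 mul1r.
have [dr dl] := glued_deriv0 tP tQ (fun x x0 => TP x (ltW x0)) TQ.
split.
  apply: (glued_punctured tP tQ) => // k.
  - by apply: rapidly_decreasingD => //; apply: rapidly_decreasingW (rE k).
  - apply: rapidly_decreasingD; first by apply: rapidly_decreasingW (rE k).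
    do 2 apply: rapidly_decreasingZ; apply: rapidly_decreasing_reflect.
    by apply: rapidly_decreasingW (rV k) => _ [x /= x0 <-]; rewrite oppr_gt0.
move=> k; rewrite !dr !dl /P /Q !oppr0 Eodd VS Weven.
by rewrite exprS sign_double; split; ring.
Qed.

End Preservation.

Theorem proposition3p2 (R : realType) (alpha : R) (beta : \bar R)
    (alpha_gt0 : 0 < alpha) (beta_ge0 : (0 <= beta)%E)
    (t : R) (t_gt0 : 0 < t) (H : R -> R) (SH : schwartz_beta alpha beta H) :
  schwartz_beta alpha beta (Delta H) /\
  schwartz_beta alpha beta (T_beta alpha beta t H).
Proof.
move: SH; rewrite /schwartz_beta /T_beta; case: ifP => _.
  by move=> SH; split; [exact: Delta_schwartz|exact: schwartz_T_line].
case: ifP => _ [pH bH]; have [pD dr dl] := Delta_punctured pH.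
- split; last exact: robin_T_robin.
  by split; [exact: pD|move=> k; rewrite !dr !dl -!doubleS; exact: bH].
- split; last exact: neumann_T_neumann.
  by split; [exact: pD|move=> k; rewrite !dr !dl -!doubleS; exact: bH].
Qed.
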